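(* Let $X$ be a Hausdorff topological space with a countable $k$-network (for example, an $\aleph_0$-space). If a topological space $Y$ has the strong Pytkeev property at a point $e\in Y$, then the function space $C_k(X,Y)$ has the strong Pytkeev property at the constant function $f:X\to\{e\}\subset Y$.
   Context: A subset $A$ of a topological space $X$ accumulates at a point $x\in X$ if each neighborhood of $x$ contains infinitely many points of $A$. A topological space $X$ has the strong Pytkeev property at a point $x\in X$ if there is a countable family $\mathcal N$ of subsets of $X$ such that for every neighborhood $O_x\subset X$ of $x$ and every subset $A\subset X$ accumulating at $x$ there is a set $N\in\mathcal N$ such that $N\subset O_x$ and $N\cap A$ is infinite. A family $\mathcal N$ of subsets of a topological space $X$ is a $k$-network in $X$ if for any open set $U\subset X$ and compact subset $K\subset U$ there is a finite subfamily $\mathcal F\subset\mathcal N$ such that $K\subset\bigcup\mathcal F\subset U$. An $\aleph_0$-space is a regular (in particular Hausdorff) topological space with a countable $k$-network. $C_k(X,Y)$ denotes the space of all continuous functions from $X$ to $Y$ with the compact-open topology. *)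

(* Defs.v *)
From HB Require Import structures.
From mathcomp Require Import all_boot.
From mathcomp Require Import boolp classical_sets functions cardinality.
From mathcomp Require Import topology.

Set Implicit Arguments.
Unset Strict Implicit.
Unset Printing Implicit Defensive.

Local Open Scope classical_set_scope.

Definition accumulating_at (X : topologicalType) (A : set X) (x : X) : Prop :=
  forall O : set X, nbhs x O -> infinite_set (O `&` A).

Definition strong_Pytkeev_at (X : topologicalType) (x : X) : Prop :=
  exists N : set (set X),
    countable N /\
    forall (O A : set X), nbhs x O -> accumulating_at A x ->
      exists B : set X, [/\ N B, B `<=` O & infinite_set (B `&` A)].

Definition k_network (X : topologicalType) (N : set (set X)) : Prop :=
  forall U K : set X, open U -> compact K -> K `<=` U ->
    exists F : set (set X),
      [/\ finite_set F, F `<=` N, K `<=` \bigcup_(B in F) B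
        & \bigcup_(B in F) B `<=` U].

(* [{compact-open, X -> Y}] consists of all functions from X to Y; C_k(X,Y) is
   the type of continuous ones with the topology induced from it. *)
Definition Ck (X Y : topologicalType) : topologicalType :=
  initial_topology
    ((fun f => f) : continuousType X Y -> {compact-open, X -> Y}).

Definition Ck_cst (X Y : topologicalType) (y : Y) : Ck X Y :=
  (cst y : X -> Y) : continuousType X Y.

(* Main.v *)
Require Import Defs.
From mathcomp Require Import all_boot.
From mathcomp Require Import boolp classical_sets functions cardinality.
From mathcomp Require Import finmap topology.

(** The constant function [e] has a neighbourhood base of sets [maps K U] of the
    functions that map a compact [K] into an open [U] containing [e]. Choose
    [L], a countable k-network of [X] closed under finite unions, and [h], a
    countable family of subsets of [Y] with the strong Pytkeev property at [e],
    and consider the countably many sets [maps L' P] with [L'] a finite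
    intersection of members of [L] and [P] a finite union of members of [h].

    Given [maps K U], let [K_m] be the intersection of those among the first
    [m] members of [L] that contain [K], and [P_m] the union of those among the
    first [m] members of [h] that are inside [U]. Then [maps K_m P_m] increases
    with [m] and is inside [maps K U]. If a family [A] of functions accumulates
    at the constant [e], some [maps K_m P_m] contains infinitely many of its
    members. Otherwise every [m] yields a witness [x] in [K_m] with [f x]
    outside [P_m], for all [f] in [A] but finitely many. The [K_m] shrink to
    [K], so that witnesses at growing [m] converge to [K]. The idea is to use
    them to build a family of values [f x] that accumulates at [e] in [Y] but
    has only finitely many members in each [P_m]; this contradicts the strong
    Pytkeev property of [Y]. It takes two constructions.

    For the functions that are in some [maps K_m P_m], one takes the witness at
    the last failing [m]. All these witnesses together with [K] form a compact
    set, and [A] accumulates at [e] uniformly on it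
    ([covered_not_accumulating]). For the functions that are in none, possibly
    uncountably many, one lets the witnesses of each single function cluster
    in [K], extracts countably many functions by the strong Pytkeev property
    applied to the values at the cluster points, and goes back from the cluster
    points to witnesses of large index ([uncovered_not_accumulating]). *)

Set Implicit Arguments.
Unset Strict Implicit.
Unset Printing Implicit Defensive.
Local Open Scope classical_set_scope.

(** * Compact sets and what converges to them *)

(** Each point of [K] is outside the closure of some member of [F], and
    compactness makes one member serve for all of [K]. *)
Lemma compact_disjoint_cluster (T : topologicalType) (K : set T) (F : set_system T) :
  compact K -> ProperFilter F -> K `&` cluster F = set0 ->
  exists2 A, F A & K `<=` ~` closure A.
Proof.
move=> /compact_near_coveringP cK FF K0.
have /cK : forall x, K x -> \forall x' \near x & A \near powerset_filter_from F,
    ~ closure A x'.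
  move=> x Kx; have : ~ cluster F x by move=> Fx; rewrite -[False]/(set0 x) -K0.
  rewrite clusterE => /existsNP[A /not_implyP[FA nAx]].
  exists (~` closure A, [set B | F B /\ B `<=` A]) => /=.
    split; last exact: powerset_filter_fromP.
    by apply: open_nbhs_nbhs; split => //; rewrite openC; exact: closed_closure.
  by move=> [y B] /= [nAy [_ BA]] By; apply/nAy/(closureS BA By).
rewrite near_powerset_filter_fromP => [|A B AB KB x /KB nBx Ax].
  by case=> A FA KA; exists A.
by apply: nBx; exact: closureS Ax.
Qed.

(** Used for a sequence of points that converges to [K] as a whole: it clusters
    at a point of [K]. *)
Lemma compact_cluster_neighborhoods (T : topologicalType) (K : set T)
    (F : set_system T) :
  compact K -> ProperFilter F -> (forall W, open W -> K `<=` W -> F W) ->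
  K `&` cluster F !=set0.
Proof.
move=> cK FF FK; apply/set0P/eqP => K0.
have [A FA KA] := compact_disjoint_cluster cK _ K0.
have /(filterI FA) : F (~` closure A).
  by apply: FK => //; rewrite openC; exact: closed_closure.
by move=> /filter_ex[x [Ax []]]; exact: subset_closure.
Qed.

(** A filter on [K `|` S] without cluster points in [K] has a member away from
    a neighbourhood of [K], hence lives on a finite part of [S]. *)
Lemma compactU_converging (T : topologicalType) (K S : set T) :
  compact K -> (forall W, open W -> K `<=` W -> finite_set (S `\` W)) ->
  compact (K `|` S).
Proof.
move=> cK SK F FF FKS; have [K0|/set0P[x [Kx Fx]]] := eqVneq (K `&` cluster F) set0.
  have [A FA KA] := compact_disjoint_cluster cK _ K0.
  have oA : open (~` closure A) by rewrite openC; exact: closed_closure.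
  have [|x [[Sx _] Fx]] := finite_compact (SK _ oA KA) FF; last first.
    by exists x; split=> //; right.
  apply: filterS (filterI FA FKS) => x [/[dup] Ax /subset_closure cAx].
  by move=> [/KA//|Sx]; split=> // /(_ cAx).
by exists x; split=> //; left.
Qed.

(** * Enumerated networks *)

Lemma countable_range (T : Type) (N : set T) (t0 : T) :
  countable N -> exists g : nat -> T, N `<=` range g.
Proof.
move=> /pfcard_geP[->|[g]]; first by exists (fun=> t0).
by exists g => x /(@surj _ _ _ _ g)[n _ <-]; exists n.
Qed.

(** A single member takes the place of the finite subfamily in a k-network,
    as closing the network under finite unions permits. *)
Definition k_network_enum (X : topologicalType) (L : nat -> set X) : Prop :=
  forall U K, open U -> compact K -> K `<=` U ->
    exists i, K `<=` L i /\ L i `<=` U.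

Lemma countable_k_network_enum (X : topologicalType) :
  (exists N : set (set X), countable N /\ k_network N) ->
  exists L : nat -> set X, k_network_enum L.
Proof.
move=> [N [cN kN]]; have [g Ng] := countable_range set0 cN.
pose code (i : nat) : seq nat := odflt [::]%SEQ (choice.unpickle i).
exists (fun i => \bigcup_(j in [set` code i]) g j).
move=> U K oU cK KU; have [F [finF FN KF FU]] := kN U K oU cK KU.
suff [s sF] : exists s : seq nat, \bigcup_(B in F) B = \bigcup_(j in [set` s]) g j.
  by exists (choice.pickle s); rewrite /code choice.pickleK /= -sF.
have [idx idxE] : {idx : set X -> nat & forall B, F B -> g (idx B) = B}.
  apply: (@choice _ _ (fun B n => F B -> g n = B)) => B.
  have [/FN/Ng[n _ <-]|nFB] := pselect (F B); first by exists n.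
  by exists 0.
have /finite_seqP[s sE] := finite_image idx finF.
exists s; rewrite -sE bigcup_image.
by apply: eq_bigcupr => B /idxE ->.
Qed.

(** The strong Pytkeev property for indexed families of points: infinitude is
    counted on the indices, so that points may be repeated infinitely often. *)
Definition Pytkeev_enum (Y : topologicalType) (e : Y) (h : nat -> set Y) : Prop :=
  forall (I : Type) (D : set I) (y : I -> Y) (U : set Y), nbhs e U ->
    (forall V, nbhs e V -> infinite_set (D `&` y @^-1` V)) ->
    exists j, h j `<=` U /\ infinite_set (D `&` y @^-1` h j).

(** When the points of the family are too few to make their set accumulating
    at [e], infinitely many indices give points that no neighbourhood of [e]
    avoids; adding the intersection [M] of all neighbourhoods of [e] to the
    given family of sets takes care of them (in a T1 space [M] is [e] alone). *)
Lemma strong_Pytkeev_indexed (Y : topologicalType) (e : Y) :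
  strong_Pytkeev_at e -> exists h : nat -> set Y, Pytkeev_enum e h.
Proof.
move=> [N [cN pN]]; have [g Ng] := countable_range set0 cN.
pose M : set Y := \bigcap_(V in nbhs e) V.
exists (fun j => if j is j'.+1 then g j' else M) => I D y U eU Dy.
have [finM|infM] := pselect (finite_set (D `&` y @^-1` M)); last first.
  by exists 0; split=> // z; exact.
have [|B [NB BU infB]] := pN U (y @` D) eU.
  move=> V eV finV.
  (* If the set of points did not accumulate at [e], some [V] would contain
     finitely many of them. A smaller neighbourhood avoids those outside [M],
     and leaves only the finitely many indices whose points are in [M]. *)
  have [W WE] : {W : Y -> set Y & forall z, ~ M z -> nbhs e (W z) /\ ~ W z z}.
    apply: (@choice _ _ (fun z W => ~ M z -> nbhs e W /\ ~ W z)) => z.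
    have [Mz|/existsNP[W /not_implyP[eW nWz]]] := pselect (M z); last by exists W.
    by exists setT.
  have /finite_fsetP[T TE] := finite_setD M finV.
  have eVW : nbhs e (V `&` \bigcap_(z in [set` T]) W z).
    apply: filterI => //; apply: filter_bigI => z zT.
    have : (V `&` y @` D `\` M) z by rewrite TE.
    by move=> [_ /WE[]].
  apply: Dy eVW (sub_finite_set _ finM) => i [Di [Vi Wi]]; split=> //.
  apply: contrapT => nMi; have := Wi (y i).
  rewrite -TE => WT; have [_] := WE _ nMi; apply.
  by apply: WT; split=> //; split=> //; exists i.
have [j _ gj] := Ng _ NB; exists j.+1; rewrite gj; split=> // finB.
apply: infB; apply: sub_finite_set (finite_image y finB).
by move=> z [Bz [i Di yi]]; exists i => //; split=> //=; rewrite yi.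
Qed.

(** * Neighbourhoods of a constant in the compact-open topology *)

Definition ckfun (X Y : topologicalType) (f : Ck X Y) : X -> Y :=
  (f : continuousType X Y).

Definition maps (X Y : topologicalType) (K : set X) (P : set Y) : set (Ck X Y) :=
  [set f | K `<=` ckfun f @^-1` P].

Lemma ckfun_continuous (X Y : topologicalType) (f : Ck X Y) :
  continuous (ckfun f).
Proof. exact: (@cts_fun _ _ (f : continuousType X Y)). Qed.

Lemma nbhs_maps (X Y : topologicalType) (e : Y) (K : set X) (U : set Y) :
  compact K -> open U -> U e -> nbhs (Ck_cst X e) (maps K U).
Proof.
move=> cK oU Ue; apply: open_nbhs_nbhs; split; last by move=> x _.
exists [set g : {compact-open, X -> Y} | g @` K `<=` U].
  exact: compact_open_open.
by apply/seteqP; split=> f /= fK; [move=> x Kx; apply: fK; exists x|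
  move=> _ [x Kx <-]; exact: fK].
Qed.

(** One compact set and one open set are enough, since the function is
    constant: finitely many subbasic conditions are implied by the one on the
    union of the compact sets and the intersection of the open ones. *)
Lemma nbhs_maps_ex (X Y : topologicalType) (e : Y) (O : set (Ck X Y)) :
  nbhs (Ck_cst X e) O -> exists K U,
    [/\ compact K, open U, U e & maps K U `<=` O].
Proof.
pose F : set_system {compact-open, X -> Y} := [set Q | exists K U,
  [/\ compact K, open U, U e & [set g | K `<=` g @^-1` U] `<=` Q]].
have FF : Filter F.
  split.
  - by exists set0, setT; split=> //; [exact: compact0|exact: openT].
  - move=> P Q [K [U [cK oU Ue KUP]]] [K' [U' [cK' oU' Ue' KUQ]]].
    exists (K `|` K'), (U `&` U'); split=> //; [exact: compactU|exact: openI|].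
    move=> f fK; split; [apply: KUP|apply: KUQ] => x Kx.
      by have [] := fK x (or_introl Kx).
    by have [] := fK x (or_intror Kx).
  - move=> P Q PQ [K [U [cK oU Ue KUP]]]; exists K, U; split=> //.
    exact: subset_trans PQ.
have Fe : F --> (cst e : {compact-open, X -> Y}).
  apply/compact_open_cvgP => K U cK oU KU.
  (* For empty [K] the set [U] need not contain [e]. *)
  have [->|/set0P[x Kx]] := eqVneq K set0.
    exists set0, setT; split=> //; [exact: compact0|exact: openT|].
    by move=> f _ z [x []].
  exists K, U; split=> //; first by apply: KU; exists x.
  by move=> f fK _ [z Kz <-]; exact: fK.
rewrite nbhsE => -[_ [[Q oQ <-] Qe] QO].
have [K [U [cK oU Ue KUQ]]] := Fe _ (open_nbhs_nbhs (conj oQ Qe)).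
by exists K, U; split=> //; apply: subset_trans QO => f; exact: KUQ.
Qed.

(** * Approximating a compact set and a neighbourhood *)

(** For an enumerated k-network [L], the sets [outer L K m] decrease with [m]
    into every open neighbourhood of the compact [K]; [inner h U m] increases
    with [m] and exhausts the sets [h j] that are inside [U]. The sets [maps (outer L K m) (inner h U m)]
    are the candidates for catching infinitely many functions. *)
Definition outer (X : Type) (L : nat -> set X) (K : set X) (m : nat) : set X :=
  \bigcap_(i in [set i | (i < m)%N /\ K `<=` L i]) L i.

Definition inner (Y : Type) (h : nat -> set Y) (U : set Y) (m : nat) : set Y :=
  \bigcup_(j in [set j | (j < m)%N /\ h j `<=` U]) h j.

Lemma subset_outer X (L : nat -> set X) K m n : (m <= n)%N ->
  outer L K n `<=` outer L K m.
Proof. by move=> mn x Kx i [im KL]; apply: Kx; split=> //; exact: leq_trans mn. Qed.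

Lemma subset_inner Y (h : nat -> set Y) U m n : (m <= n)%N ->
  inner h U m `<=` inner h U n.
Proof.
by move=> mn y [j [jm hU] hy]; exists j => //; split=> //; exact: leq_trans mn.
Qed.

Lemma outer_sub_open (X : topologicalType) (L : nat -> set X) (K W : set X) :
  k_network_enum L -> compact K -> open W -> K `<=` W ->
  exists m, outer L K m `<=` W.
Proof.
move=> kL cK oW KW; have [i [KL LW]] := kL _ _ oW cK KW.
by exists i.+1 => x Kx; apply/LW/Kx.
Qed.

Lemma Pytkeev_enum_inner (Y : topologicalType) (e : Y) (h : nat -> set Y)
    (I : Type) (D : set I) (y : I -> Y) (U : set Y) :
  Pytkeev_enum e h -> nbhs e U ->
  (forall V, open V -> V e -> infinite_set (D `&` y @^-1` V)) ->
  exists m, infinite_set (D `&` y @^-1` inner h U m).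
Proof.
move=> ph eU Dy; have [V|j [hU infj]] := ph I D y U eU.
  rewrite nbhsE => -[W [oW We] WV].
  by apply: sub_infinite_set (Dy W oW We) => i [Di /WV].
exists j.+1; apply: sub_infinite_set infj => i [Di hy]; split=> //.
by exists j.
Qed.

(** * Two families of functions that do not accumulate *)

Lemma finite_nat_bounded (A : set nat) : finite_set A ->
  exists n, forall m, A m -> (m < n)%N.
Proof.
move=> /finite_seqP[s ->]; exists (\max_(i <- s) i).+1 => m /= ms.
by rewrite ltnS; exact: leq_bigmax_seq.
Qed.

(** Leaving out the finitely many [f] that never fail, each [f] of [A] fails
    for a last time to map [outer L K m] into [inner h U m], at an index [m]
    called the rank of [f], and a witness [x_f] in [outer L K m] shows it. Only
    finitely many functions have a rank below a given bound, so that the points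
    [x_f] converge to [K] and form with it a compact set; if [A] accumulated at
    the constant [e], infinitely many [f x_f] would then be in each
    neighbourhood of [e], hence infinitely many in some [inner h U m], which
    bounds the ranks of infinitely many functions. *)
Lemma covered_not_accumulating (X Y : topologicalType) (e : Y)
    (L : nat -> set X) (h : nat -> set Y) (K : set X) (U : set Y)
    (A : set (Ck X Y)) (x0 : X) :
  k_network_enum L -> Pytkeev_enum e h -> compact K -> nbhs e U ->
  (forall m, finite_set (maps (outer L K m) (inner h U m) `&` A)) ->
  (forall f, A f -> exists m, maps (outer L K m) (inner h U m) f) ->
  ~ accumulating_at A (Ck_cst X e).
Proof.
move=> kL ph cK eU; pose E m : set (Ck X Y) := maps (outer L K m) (inner h U m).
move=> finE AE accA.
have subE m n : (m <= n)%N -> E m `<=` E n.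
  move=> mn f Ef x Kx; apply: (subset_inner mn); apply: Ef.
  exact: subset_outer Kx.
pose D := A `\` E 0.
(* [d f] is the rank of [f] with its witness. *)
have [d dE] : {d : Ck X Y -> nat * X & forall f, D f ->
    [/\ E (d f).1.+1 f, outer L K (d f).1 (d f).2
      & ~ inner h U (d f).1 (ckfun f (d f).2)]}.
  apply: (@choice _ _ (fun f d => D f -> [/\ E d.1.+1 f, outer L K d.1 d.2
      & ~ inner h U d.1 (ckfun f d.2)])) => f.
  have [[Af nE0]|nDf] := pselect (D f); last by exists (0, x0).
  have [m [nEm Em]] : exists m, ~ E m f /\ E m.+1 f.
    have [m Em] := AE _ Af; elim: m Em => [//|m IH Em].
    by have [/IH//|nEm] := pselect (E m f); exists m.
  have [x xK nPx] : exists2 x, outer L K m x & ~ inner h U m (ckfun f x).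
    by apply/existsPNP => mf; apply: nEm => x /mf.
  by exists (m, x).
have finD m : finite_set (D `&` [set f | (d f).1 < m]%N).
  apply: sub_finite_set (finE m) => f [Df dm]; split; last by case: Df.
  by have [Ef _ _] := dE _ Df; exact: subE Ef.
pose S := (fun f => (d f).2) @` D.
have cS : compact (K `|` S).
  apply: compactU_converging => // W oW KW.
  have [m mW] := outer_sub_open kL cK oW KW.
  apply: sub_finite_set (finite_image (fun f => (d f).2) (finD m)).
  move=> x [[f Df <-] nWx]; exists f => //; split=> //=.
  rewrite ltnNge; apply/negP => md; apply/nWx/mW.
  by have [_ fx _] := dE _ Df; exact: subset_outer fx.
have [V oV Ve|m] := Pytkeev_enum_inner (D := D)
    (y := fun f => ckfun f (d f).2) ph eU.
  have := infinite_setD (accA _ (nbhs_maps cS oV Ve)) (finE 0).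
  apply: sub_infinite_set => f [[fV Af] nEf].
  have Df : D f by split=> // E0f; apply: nEf.
  by split=> //; apply: fV; right; exists f.
apply; apply: sub_finite_set (finD m) => f [Df fm]; split=> //=.
rewrite ltnNge; apply/negP => md.
by have [_ _] := dE _ Df; apply; exact: subset_inner fm.
Qed.

(** Now each [f] of [A] fails at every [m], with a witness [x_(f, m)] in
    [outer L K m]; these witnesses cluster, as [m] grows, at a point [c_f] of
    [K]. If [A] accumulated at the constant [e], infinitely many [f c_f] would
    be in each neighbourhood of [e], and by the property of [h] this is already
    seen on a sequence [s_j] of functions. Near [c_(s_j)] there are witnesses
    of [s_j] with arbitrarily large [m], so that the doubly indexed family of
    the values [s_j x_(s_j, m)] with [j <= m] meets every neighbourhood of [e]
    infinitely often. Then it also meets some [inner h U M] infinitely often,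
    although this forces [j <= m < M].

    One witness for each function, as in [covered_not_accumulating], does not
    suffice here: [A] may be uncountable, and such witnesses need not converge
    to [K]. *)
Lemma uncovered_not_accumulating (X Y : topologicalType) (e : Y)
    (L : nat -> set X) (h : nat -> set Y) (K : set X) (U : set Y)
    (A : set (Ck X Y)) (x0 : X) :
  k_network_enum L -> Pytkeev_enum e h -> compact K -> nbhs e U ->
  (forall f m, A f -> ~ maps (outer L K m) (inner h U m) f) ->
  ~ accumulating_at A (Ck_cst X e).
Proof.
move=> kL ph cK eU nE accA.
have [x xE] : {x : Ck X Y * nat -> X & forall fm, A fm.1 ->
    outer L K fm.2 (x fm) /\ ~ inner h U fm.2 (ckfun fm.1 (x fm))}.
  apply: (@choice _ _ (fun fm x => A fm.1 -> outer L K fm.2 x /\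
    ~ inner h U fm.2 (ckfun fm.1 x))) => -[f m] /=.
  have [Af|nAf] := pselect (A f); last by exists x0.
  have [x xK nPx] : exists2 x, outer L K m x & ~ inner h U m (ckfun f x).
    by apply/existsPNP => mf; apply: (nE f m Af) => x /mf.
  by exists x.
have [c cE] : {c : Ck X Y -> X & forall f, A f ->
    K (c f) /\ forall B, nbhs (c f) B -> forall n, exists2 m, (n <= m)%N & B (x (f, m))}.
  apply: (@choice _ _ (fun f c => A f -> K c /\ forall B, nbhs c B ->
    forall n, exists2 m, (n <= m)%N & B (x (f, m)))) => f.
  have [Af|nAf] := pselect (A f); last by exists x0.
  have [W oW KW|c [Kc clc]] :=
      @compact_cluster_neighborhoods _ K ((fun m => x (f, m)) @ \oo) cK _.
    have [m mW] := outer_sub_open kL cK oW KW.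
    exists m => // n /= mn; apply/mW.
    by apply: subset_outer mn _ _; exact: (xE (f, n) Af).1.
  exists c => _; split=> // B cB n.
  have [|_ [[m nm <-] Bx]] := clc ((fun m => x (f, m)) @` [set m | n <= m]%N) B _ cB.
    by exists n => // m nm; exists m.
  by exists m.
have infc V : nbhs e V -> infinite_set (A `&` (fun f => ckfun f (c f)) @^-1` V).
  rewrite nbhsE => -[W [oW We] WV].
  apply: sub_infinite_set (accA _ (nbhs_maps cK oW We)) => f [fW Af].
  by split=> //; apply/WV/fW; exact: (cE _ Af).1.
have [f0 Af0] : A !=set0.
  by have [f []] := infinite_setN0 (infc setT filterT); exists f.
(* [s j] is chosen with [s j (c (s j))] in [h j] whenever possible. *)
have [s sE] : {s : nat -> Ck X Y & forall j, A (s j) /\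
    ((A `&` (fun f => ckfun f (c f)) @^-1` h j) !=set0 ->
      h j (ckfun (s j) (c (s j))))}.
  apply: (@choice _ _ (fun j f => A f /\
    ((A `&` (fun f => ckfun f (c f)) @^-1` h j) !=set0 ->
      h j (ckfun f (c f))))) => j.
  have [[f [Af hf]]|nA] :=
      pselect ((A `&` (fun f => ckfun f (c f)) @^-1` h j) !=set0).
    by exists f.
  by exists f0.
have sV V : nbhs e V -> exists j, V (ckfun (s j) (c (s j))).
  move=> eV; have [j [hV /infinite_setN0 hj]] := ph _ _ _ _ eV infc.
  by exists j; apply/hV/(sE j).2.
have [V oV Ve|M] := Pytkeev_enum_inner (D := [set jm : nat * nat | jm.1 <= jm.2]%N)
    (y := fun jm => ckfun (s jm.1) (x (s jm.1, jm.2))) ph eU.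
  have [j Vj] := sV _ (open_nbhs_nbhs (conj oV Ve)).
  have cV : nbhs (c (s j)) (ckfun (s j) @^-1` V).
    by apply: ckfun_continuous; exact: open_nbhs_nbhs.
  move=> /(finite_image snd)/finite_nat_bounded[n nP].
  have [m nm Vm] := (cE _ (sE j).1).2 _ cV (maxn j n).
  have : (m < n)%N.
    by apply: nP; exists (j, m) => //; split=> //=; apply: leq_trans nm; exact: leq_maxl.
  by rewrite ltnNge (leq_trans (leq_maxr _ _) nm).
apply; apply: sub_finite_set (finite_setX (finite_II M) (finite_II M)).
move=> [j m] /= [jm jmM]; suff mM : (m < M)%N.
  by split=> //=; exact: leq_ltn_trans mM.
rewrite ltnNge; apply/negP => Mm.
by have [_] := xE (s j, m) (sE j).1; apply; exact: subset_inner jmM.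
Qed.

(** * The strong Pytkeev property of the function space *)

Lemma bounded_set_seq (P : nat -> Prop) m :
  exists s : seq nat, [set i | (i < m)%N /\ P i] = [set` s].
Proof.
exists [seq i <- iota 0 m | `[< P i >]].
apply/seteqP; split=> i /=; rewrite mem_filter mem_iota add0n.
  by move=> [-> Pi]; rewrite leq0n !andbT; exact: asboolT.
by move=> /andP[/asboolW Pi im].
Qed.

(** If all the sets in question were finite, one of the two halves of [A], of
    the functions caught at some [m] and of those never caught, would still
    accumulate. *)
Lemma accumulating_infinite_maps (X Y : topologicalType) (e : Y)
    (L : nat -> set X) (h : nat -> set Y) (K : set X) (U : set Y)
    (A : set (Ck X Y)) :
  k_network_enum L -> Pytkeev_enum e h -> compact K -> nbhs e U ->
  accumulating_at A (Ck_cst X e) ->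
  exists m, infinite_set (maps (outer L K m) (inner h U m) `&` A).
Proof.
move=> kL ph cK eU accA; apply: contrapT => /forallNP finE.
have {}finE m : finite_set (maps (outer L K m) (inner h U m) `&` A).
  exact: contrapT (finE m).
have [f [Af nE0]] : (A `\` (maps (outer L K 0) (inner h U 0) `&` A)) !=set0.
  apply: infinite_setN0; apply: infinite_setD (finE 0).
  by apply: sub_infinite_set (accA setT filterT) => f [].
(* A function that is not caught provides a point of [X], used as a default
   value in the choices. *)
have [x0 _ _] : exists2 x, outer L K 0 x & ~ inner h U 0 (ckfun f x).
  by apply/existsPNP => mf; apply: nE0; split=> // x /mf.
pose C := \bigcup_m maps (outer L K m) (inner h U m) : set (Ck X Y).
have /existsNP[O1 /not_implyP[eO1 /contrapT finO1]] :
    ~ accumulating_at (A `&` C) (Ck_cst X e).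
  apply: (covered_not_accumulating x0 kL ph cK eU) => [m|g [_ [m _ Em]]].
    by apply: sub_finite_set (finE m) => g [Eg []].
  by exists m.
have /existsNP[O2 /not_implyP[eO2 /contrapT finO2]] :
    ~ accumulating_at (A `\` C) (Ck_cst X e).
  apply: (uncovered_not_accumulating x0 kL ph cK eU) => g m [_ nCg] Eg.
  by apply: nCg; exists m.
apply: accA (filterI eO1 eO2) _.
have : finite_set ((O1 `&` (A `&` C)) `|` (O2 `&` (A `\` C))).
  by rewrite finite_setU.
apply: sub_finite_set => g [[O1g O2g] Ag].
by have [Cg|nCg] := pselect (C g); [left|right].
Qed.

Theorem corollary2p6 (X Y : topologicalType) (e : Y)
    (hausX : hausdorff_space X)
    (knetX : exists N : set (set X), countable N /\ k_network N)
    (pytY : strong_Pytkeev_at e) :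
  strong_Pytkeev_at (Ck_cst X e).
Proof.
have [L kL] := countable_k_network_enum knetX.
have [h ph] := strong_Pytkeev_indexed pytY.
pose N (st : seq nat * seq nat) : set (Ck X Y) :=
  maps (\bigcap_(i in [set` st.1]) L i) (\bigcup_(j in [set` st.2]) h j).
exists (range N); split.
  exact: sub_countable (card_image_le N setT) _.
move=> O A eO accA; have [K [U [cK oU Ue KUO]]] := nbhs_maps_ex eO.
have eU : nbhs e U by exact: open_nbhs_nbhs.
have [m infm] := accumulating_infinite_maps kL ph cK eU accA.
exists (maps (outer L K m) (inner h U m)); split=> //.
  have [s sE] := bounded_set_seq (fun i => K `<=` L i) m.
  have [t tE] := bounded_set_seq (fun j => h j `<=` U) m.
  by exists (s, t) => //=; rewrite /N /outer /inner sE tE.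
move=> f fm; apply: KUO => x Kx; have [j [_ hU] hj] : inner h U m (ckfun f x).
  by apply: fm => i [_]; apply.
exact: hU.
Qed.
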